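(* Let $s_0\ge0$, $\delta>0$, $m\ge0$, and $b,c\in\mathbb R$. Impose the following conditions: if $s_0=0$ and $m>0$, assume $b>0$ and $c=0$; if $s_0>0$, assume $\delta<s_0$, so that $[s_0-\delta,s_0+\delta]\subset(0,\infty)$. Let $I=[\max\{0,s_0-\delta\},s_0+\delta]$ and consider the initial value problem $$\bigl(r^{m}u'(r)\bigr)'=r^{m}a(r)u(r),\qquad u(s_0)=b,\quad u'(s_0)=c,\qquad(\ast)$$ where the coefficient $a\in L^1(I)$ is continuous on $I\setminus\{s_0\}$. Then: (i) There exists a unique solution $u$ of $(\ast)$ with the regularity $u\in C^1(I)\cap C^2(I\setminus\{s_0\})$. (ii) Let $\bar a\in L^1(I)$ be continuous on $I\setminus\{s_0\}$, and let $\bar u$ be the corresponding solution of $(\ast)$ with coefficient $\bar a$ and the same initial data $(b,c)$. If $\|\bar a-a\|_{L^1(I)}$ is sufficiently small, then $$\|\bar u-u\|_{C^1(I)}\le C\,\|\bar a-a\|_{L^1(I)},$$ where the constant $C>0$ depends only on $m,s_0,\delta,b,c$ and $\|a\|_{L^1(I)}$.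
   Context: The differential equation is understood to hold pointwise on $I\setminus\{s_0\}$ (where $a$ is continuous and $u$ is $C^2$), and the initial conditions hold at $s_0$ (one-sided derivative if $s_0=0$). $\|w\|_{C^1(I)}=\sup_I|w|+\sup_I|w'|$. *)

(* Defs.v *)
From HB Require Import structures.
From mathcomp Require Import all_boot all_order all_algebra.
From mathcomp Require Import all_classical all_reals all_analysis.

Set Implicit Arguments.
Unset Strict Implicit.
Unset Printing Implicit Defensive.

Import Order.TTheory GRing.Theory Num.Theory.
Import numFieldNormedType.Exports.

Local Open Scope classical_set_scope.
Local Open Scope ring_scope.

Section RadialODE.
Context {R : realType}.
Implicit Types (D : set R) (u f a : R -> R) (s delta m b c x : R).

(* Derivative relative to [D]: two-sided at interior points of [D], one-sided
   at the endpoints of an interval.  As for the library's [derivable] and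
   [derive], the value [derive_within D u x] is only meaningful when
   [derivable_within D u x] holds. *)
Definition derivable_within D u x : Prop :=
  cvg ((u y - u x) / (y - x) @[y --> within D x^']).

Definition derive_within D u x : R :=
  lim ((u y - u x) / (y - x) @[y --> within D x^']).

Definition C1_on D u : Prop :=
  (forall x, D x -> derivable_within D u x) /\
  {within D, continuous (derive_within D u)}.

Definition C2_on D u : Prop :=
  C1_on D u /\ C1_on D (derive_within D u).

Definition interval_of s0 delta : set R :=
  `[Num.max 0 (s0 - delta), s0 + delta]%classic.

Definition punctured_interval_of s0 delta : set R :=
  interval_of s0 delta `\ s0.

Definition admissible_coef s0 delta a : Prop :=
  lebesgue_measure.-integrable (interval_of s0 delta) (EFin \o a) /\
  {within punctured_interval_of s0 delta, continuous a}.

Definition is_solution s0 delta m b c a u : Prop :=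
  let I := interval_of s0 delta in
  let J := punctured_interval_of s0 delta in
  [/\ C1_on I u,
      C2_on J u,
      forall r, J r ->
        derive_within J (fun t => t `^ m * derive_within J u t) r =
        r `^ m * a r * u r,
      u s0 = b
    & derive_within I u s0 = c].

Definition L1norm D f : \bar R :=
  (\int[lebesgue_measure]_(x in D) `|f x|%:E)%E.

Definition C1norm D f : \bar R :=
  (ereal_sup [set `|f x|%:E | x in D] +
   ereal_sup [set `|derive_within D f x|%:E | x in D])%E.

End RadialODE.

(* Main.v *)
(* Write [w = u']. Integrating the equation from [s0] gives
   [r^m w(r) = s0^m c + \int_s0^r t^m a u], and since [t^m <= K r^m] whenever
   [|t - s0| <= |r - s0|], the singular weight disappears from
   [|w(r)| <= K |c| + K ||a||_1 sup |u|], the supremum being over the points at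
   distance at most [|r - s0|] from [s0]. Passing from [w] back to [u] costs one
   more integration, which in the norm [sup e^(- l |r - s0|) |u(r)|] gains a
   factor [1 / l] whatever the L^1 coefficient [a] is. For [l] large this makes
   the Picard map contracting (existence), and it turns the same bound for a
   difference of two solutions into uniqueness and stability. *)

Require Import Defs.
From HB Require Import structures.
From mathcomp Require Import all_boot all_order all_algebra.
From mathcomp Require Import all_classical all_reals all_analysis.
From mathcomp Require Import measurable_realfun.
From mathcomp Require Import ring lra.

Import Order.TTheory GRing.Theory Num.Theory.
Import numFieldNormedType.Exports.

Local Open Scope classical_set_scope.
Local Open Scope ring_scope.
Set Implicit Arguments.
Unset Strict Implicit.
Unset Printing Implicit Defensive.

(** * Derivatives relative to a set, one-sided at the ends of a segment *)

Section derive_within.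
Context {R : realType}.
Implicit Types (D E : set R) (f g : R -> R) (x y l k a b : R).

(** Two difficulties meet at [s0]: the weight may vanish there ([s0 = 0] and [m > 0]), and the
    coefficient is only integrable near it, so the differential equation gives no information at
    that point. What joins the two sides is the continuity of [u']: the function [r^m u'] minus the
    integral of [t^m a u] has derivative zero off [s0] and is continuous at [s0], hence is constant.

    When the weight vanishes at [s0], bounding the weight by its value at a farther point works only
    for points nearer to [s0]. The bound on [u'] at [r] therefore speaks only of [u] at points no
    farther from [s0] than [r]. The factor [e^(l |r - s0|)] is nondecreasing in this distance, so a
    bound of that form at [r] covers all these points, on both sides of [s0] at once. This is why
    one inequality of Gronwall type serves the regular and the singular case alike. *)

Definition has_derive_within D f x l : Prop :=
  (f y - f x) / (y - x) @[y --> within D x^'] --> l.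

Lemma near_withinP D x (P : R -> Prop) :
  (\forall y \near within D (nbhs x), P y) <->
  exists2 d : R, 0 < d & forall y, D y -> `|y - x| < d -> P y.
Proof.
split.
  rewrite near_withinE => /nbhs_ballP[d d0 dP]; exists d => // y Dy yx.
  by apply: dP => //; rewrite /ball/= distrC.
move=> [d d0 dP]; rewrite near_withinE; apply/nbhs_ballP; exists d => // y.
by rewrite /ball/= distrC => yx Dy; exact: dP.
Qed.

Lemma near_within_dnbhsP D x (P : R -> Prop) :
  (\forall y \near within D x^', P y) <->
  exists2 d : R, 0 < d & forall y, D y -> y != x -> `|y - x| < d -> P y.
Proof.
split.
  rewrite near_withinE near_withinE => /nbhs_ballP[d d0 dP].
  exists d => // y Dy yx xyd; apply: dP => //.
  by rewrite /ball/= distrC.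
move=> [d d0 dP]; rewrite !near_withinE; apply/nbhs_ballP; exists d => // y.
by rewrite /ball/= distrC => yx ynx Dy; exact: dP.
Qed.

(** Nondegeneracy makes every point, endpoints included, a limit point of the segment: step to the
    right by [d / 2], or to the left when [x = b]. Properness is what makes the limit defining
    [derive_within] unique. *)
Lemma within_dnbhs_proper a b x : a < b -> x \in `[a, b] ->
  ProperFilter (within `[a, b]%classic x^').
Proof.
move=> ab; rewrite in_itv/= => /andP[ax xb].
apply: Build_ProperFilter_ex => P /near_within_dnbhsP[d d0 dP].
have [xltb|bx] := ltP x b.
  exists (Num.min b (x + d / 2)); apply: dP.
  - rewrite /= in_itv/= ge_min lexx/= le_min (le_trans ax xb)/=.
    by rewrite (le_trans ax)// lerDl divr_ge0// ltW.
  - by rewrite gt_eqF// lt_min xltb ltrDl divr_gt0.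
  - rewrite ger0_norm; last first.
      by rewrite subr_ge0 le_min xb lerDl divr_ge0// ltW.
    by rewrite ltrBlDl gt_min [X in _ || X](_ : _ = true) ?orbT//; lra.
have ? : x = b by apply/eqP; rewrite eq_le xb bx.
subst x; exists (Num.max a (b - d / 2)); apply: dP.
- by rewrite /= in_itv/= le_max lexx/= ge_max ax/=; lra.
- by rewrite lt_eqF// gt_max ab/=; lra.
- rewrite ler0_norm; last by rewrite subr_le0 ge_max ax; lra.
  by rewrite opprB ltrBlDl -ltrBlDr lt_max [X in _ || X](_ : _ = true) ?orbT//; lra.
Qed.

(** The ball of radius [|x - s|] around [x] misses [s]. This lets derivatives on the punctured
    interval be computed relative to the full one. *)
Lemma within_dnbhsD1 D x s : x != s -> within (D `\ s) x^' = within D x^'.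
Proof.
move=> xs; apply/seteqP; split => P /near_within_dnbhsP[d d0 dP];
  apply/near_within_dnbhsP.
  exists (Num.min d `|x - s|); first by rewrite lt_min d0 normr_gt0 subr_eq0.
  move=> y Dy yx; rewrite lt_min => /andP[yd yxs]; apply: dP => //; split => //.
  by move=> ys; move: yxs; rewrite ys distrC ltxx.
by exists d => // y [Dy _]; exact: dP.
Qed.

Lemma within_nbhsD1 D x s : x != s ->
  within (D `\ s) (nbhs x) = within D (nbhs x).
Proof.
move=> xs; apply/seteqP; split => P /near_withinP[d d0 dP]; apply/near_withinP.
  exists (Num.min d `|x - s|); first by rewrite lt_min d0 normr_gt0 subr_eq0.
  move=> y Dy; rewrite lt_min => /andP[yd yxs]; apply: dP => //; split => //.
  by move=> ys; move: yxs; rewrite ys distrC ltxx.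
by exists d => // y [Dy _]; exact: dP.
Qed.

(** The calculus below is carried out with the relation [has_derive_within], whose rules hold for
    any [D] and [x]. Uniqueness of limits enters only here, on passing to the function
    [derive_within]. *)
Lemma has_derive_withinP D f x l : ProperFilter (within D x^') ->
  has_derive_within D f x l <->
  derivable_within D f x /\ derive_within D f x = l.
Proof.
move=> FF; split=> [fl|[fx <-]]; last exact: fx.
by split; [apply/cvg_ex; exists l|apply/cvg_lim].
Qed.

Lemma eq_has_derive_within D f g x l : (forall y, D y -> f y = g y) -> D x ->
  has_derive_within D f x l -> has_derive_within D g x l.
Proof.
move=> fg Dx; apply: cvg_trans; apply: near_eq_cvg.
by apply/near_within_dnbhsP; exists 1 => // y Dy _ _; rewrite !fg.
Qed.

Lemma has_derive_withinD1 D f x s l : x != s ->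
  has_derive_within (D `\ s) f x l <-> has_derive_within D f x l.
Proof. by move=> xs; rewrite /has_derive_within within_dnbhsD1. Qed.

Lemma has_derive_within_continuous D f x l : has_derive_within D f x l ->
  f y @[y --> within D (nbhs x)] --> f x.
Proof.
move=> fl; apply/cvgrPdist_lt => e e0.
have [M M0 lM] : exists2 M : R, 0 < M & `|l| < M.
  by exists (`|l| + 1); rewrite ?ltrDl// ltr_wpDl.
have /cvgr_norm_lt/(_ _ lM)/near_within_dnbhsP[d d0 dP] := fl.
apply/near_withinP; exists (Num.min d (e / M)).
  by rewrite lt_min d0 divr_gt0.
move=> y Dy; rewrite lt_min => /andP[yd ye].
have [->|yx] := eqVneq y x; first by rewrite subrr normr0.
have := dP _ Dy yx yd.
rewrite normrM normfV ltr_pdivrMr ?normr_gt0 ?subr_eq0// => H.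
rewrite distrC (lt_le_trans H)// mulrC -ler_pdivlMr//; exact: ltW.
Qed.

Lemma has_derive_withinD D f g x k l : has_derive_within D f x k ->
  has_derive_within D g x l -> has_derive_within D (f \+ g) x (k + l).
Proof.
move=> fk gl; rewrite /has_derive_within.
under eq_fun do rewrite opprD addrACA mulrDl.
exact: cvgD.
Qed.

Lemma has_derive_withinN D f x k : has_derive_within D f x k ->
  has_derive_within D (\- f) x (- k).
Proof.
move=> fk; rewrite /has_derive_within.
under eq_fun do rewrite -opprD mulNr.
exact: cvgN.
Qed.

Lemma has_derive_withinB D f g x k l : has_derive_within D f x k ->
  has_derive_within D g x l -> has_derive_within D (f \- g) x (k - l).
Proof. by move=> fk gl; apply: has_derive_withinD => //; exact: has_derive_withinN. Qed.

Lemma has_derive_within_cst D x k : has_derive_within D (cst k) x 0.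
Proof.
rewrite /has_derive_within/=; under eq_fun do rewrite subrr mul0r.
exact: cvg_cst.
Qed.

Lemma has_derive_withinM D f g x k l : has_derive_within D f x k ->
  has_derive_within D g x l ->
  has_derive_within D (f \* g) x (k * g x + f x * l).
Proof.
move=> fk gl; rewrite /has_derive_within.
have -> : (fun y => ((f \* g) y - (f \* g) x) / (y - x)) =
  (fun y => (f y - f x) / (y - x) * g x + f y * ((g y - g x) / (y - x))).
  by apply/funext => y /=; rewrite mulrAC mulrA -mulrDl; congr (_ / _); ring.
apply: cvgD; first by apply: cvgM => //; exact: cvg_cst.
apply: cvgM => //.
have := has_derive_within_continuous fk.
by apply: cvg_trans; apply: cvg_fmap2 => P /near_withinP[d d0 dP];
  apply/near_within_dnbhsP; exists d => // y Dy _; exact: dP.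
Qed.

Lemma has_derive_withinV D f x l : f x != 0 -> has_derive_within D f x l ->
  has_derive_within D (fun y => (f y)^-1) x (- l / f x ^+ 2).
Proof.
move=> fx0 fl; have fc : f y @[y --> within D x^'] --> f x.
  have := has_derive_within_continuous fl.
  by apply: cvg_trans; apply: cvg_fmap2 => P /near_withinP[d d0 dP];
    apply/near_within_dnbhsP; exists d => // y Dy _; exact: dP.
have h : - ((f y - f x) / (y - x)) * ((f y)^-1 / f x) @[y --> within D x^'] -->
    - l * ((f x)^-1 / f x).
  apply: cvgM; first exact: cvgN.
  by apply: cvgM; [exact: cvgV|exact: cvg_cst].
have -> : - l / f x ^+ 2 = - l * ((f x)^-1 / f x) by rewrite expr2 invfM.
apply: cvg_trans h; apply: near_eq_cvg.
have nx0 : 0 < `|f x| by rewrite normr_gt0.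
have /cvgrPdist_lt/(_ _ nx0) := fc.
move=> /near_within_dnbhsP[d d0 dP]; apply/near_within_dnbhsP; exists d => //.
move=> y Dy yx yd.
have fy0 : f y != 0.
  by apply/eqP => fy0; have := dP y Dy yx yd; rewrite fy0 subr0 ltxx.
by field; rewrite fx0 fy0 subr_eq0 yx.
Qed.

Lemma is_derive_has_derive_within D f x l : is_derive x 1 f l ->
  has_derive_within D f x l.
Proof.
move=> [/cvg_ex[/= k fk]]; rewrite /derive => fl.
have {fl} kl : k = l by rewrite -fl//; exact/esym/cvg_lim.
subst k; apply/cvgrPdist_le => e e0.
move/cvgrPdist_le : fk => /(_ _ e0)/=.
rewrite near_withinE => /nbhs_ballP[d d0 dP].
apply/near_within_dnbhsP; exists d => // y Dy yx yd.
have := dP (y - x); rewrite /ball/= sub0r normrN subr_eq0 => /(_ yd yx).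
by rewrite -![_ *: _]/(_ * _) mulr1 subrK [(_)^-1 * _]mulrC.
Qed.

(** Small increments from an interior point stay in the segment, so the relative quotient is the
    ordinary one near [x]. This gives access to the mean value theorem. *)
Lemma has_derive_within_is_derive a b f x l : x \in `]a, b[ ->
  has_derive_within `[a, b]%classic f x l -> is_derive x 1 f l.
Proof.
rewrite in_itv/= => /andP[ax xb] fl.
suff fk : h^-1 *: (f (h *: 1 + x) - f x) @[h --> 0^'] --> l.
  by split; [apply/cvg_ex; exists l|exact/cvg_lim].
apply/cvgrPdist_le => e e0.
move/cvgrPdist_le : fl => /(_ _ e0)/near_within_dnbhsP[d d0 dP].
have m0 : 0 < Num.min d (Num.min (x - a) (b - x)) by rewrite !lt_min d0 !subr_gt0 ax.
rewrite near_withinE; apply/nbhs_ballP; exists (Num.min d (Num.min (x - a) (b - x))) => // h.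
rewrite /ball/= sub0r normrN !lt_min => /and3P[hd ha hb] h0.
have := dP (h + x); rewrite -![_ *: _]/(_ * _) mulr1 addrK [_ / _]mulrC; apply => //.
- move: ha hb; rewrite !ltr_norml /= in_itv/=; lra.
- by rewrite -subr_eq0 addrK.
Qed.

Lemma has_derive_within_ge0 a b f (df : R -> R) : a <= b ->
  (forall x, x \in `]a, b[ -> has_derive_within `[a, b]%classic f x (df x)) ->
  (forall x, x \in `]a, b[ -> 0 <= df x) ->
  {within `[a, b], continuous f} -> f a <= f b.
Proof.
rewrite le_eqVlt => /predU1P[-> //|ab] fdf df0 cf.
have [x xab E] : exists2 x, x \in `]a, b[ & f b - f a = df x * (b - a).
  apply: MVT => // x xab; exact: (has_derive_within_is_derive xab (fdf x xab)).
by rewrite -subr_ge0 E mulr_ge0// ?df0// subr_ge0 ltW.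
Qed.

End derive_within.

(** Serves to bound the norm of the perturbed coefficient by that of the original one, so that the
    stability constant depends on the latter alone. *)
Lemma le_Rintegral_norm_sub (R : realType) (d : measure_display)
    (T : measurableType d) (mu : {measure set T -> \bar R}) (D : set T)
    (f g : T -> R) : measurable D -> mu.-integrable D (EFin \o f) ->
  mu.-integrable D (EFin \o g) ->
  \int[mu]_(t in D) `|g t| <=
    \int[mu]_(t in D) `|f t| + \int[mu]_(t in D) `|(g \- f) t|.
Proof.
move=> mD intf intg.
have intd : mu.-integrable D (EFin \o (g \- f)).
  have -> : EFin \o (g \- f) = ((EFin \o g) \- (EFin \o f))%E by exact/funext.
  exact: integrableB.
have intnf := integrable_norm intf; have intnd := integrable_norm intd.
rewrite -RintegralD//; apply: le_Rintegral => //.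
- exact: integrable_norm intg.
- by have := integrableD mD intnf intnd.
- move=> t _; apply: le_trans (ler_normD _ _).
  by rewrite addrC subrK.
Qed.

(** * Lebesgue integrals between two points in either order *)

Section oriented_integral.
Context {R : realType}.
Implicit Types (f g : R -> R) (a b s r t x k M : R).
Local Notation mu := (@lebesgue_measure R).

(** The integral of [f] from [s] to [r], signed. The point [a] is only the left end of the ambient
    segment; taking a difference of two integrals from [a] makes sign and additivity a matter of
    algebra on both sides of [s]. *)
Definition oriented_integral a f s r : R :=
  \int[mu]_(t in `[a, r]) f t - \int[mu]_(t in `[a, s]) f t.

Definition between s r t := Num.min s r <= t <= Num.max s r.

Lemma between_dist s r t : between s r t -> `|t - s| <= `|r - s|.
Proof.
rewrite /between; have [sr|rs] := leP s r => /andP[h1 h2].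
  by rewrite !ger0_norm ?subr_ge0//; lra.
by rewrite !ler0_norm ?subr_le0//; lra.
Qed.

Lemma between_itv a b s r t : s \in `[a, b] -> r \in `[a, b] ->
  between s r t -> t \in `[a, b].
Proof.
rewrite !in_itv/= /between => /andP[h1 h2] /andP[h3 h4].
by have [sr|rs] := leP s r => /andP[h5 h6]; lra.
Qed.

Lemma itv_dist_le a b s x : s \in `[a, b] -> x \in `[a, b] ->
  `|x - s| <= b - a.
Proof.
by rewrite !in_itv/= ler_norml => /andP[? ?] /andP[? ?]; apply/andP; split; lra.
Qed.

Lemma oriented_integralC a f s r :
  oriented_integral a f r s = - oriented_integral a f s r.
Proof. by rewrite /oriented_integral opprB. Qed.

Lemma oriented_integral_id a f s : oriented_integral a f s s = 0.
Proof. exact: subrr. Qed.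

Section fixed_segment.
Variables a b : R.
Local Notation I := (`[a, b]%classic : set R).

Lemma integrable_sub_itv f (i : interval R) : [set` i] `<=` I ->
  mu.-integrable I (EFin \o f) -> mu.-integrable [set` i] (EFin \o f).
Proof. by move=> iI; apply: integrableS. Qed.

Lemma integrable_itv_cst k : mu.-integrable I (EFin \o cst k).
Proof.
by apply: continuous_compact_integrable; [exact: segment_compact|
  move=> x; exact: cvg_cst].
Qed.

Lemma oriented_integral_le f s r : mu.-integrable I (EFin \o f) ->
  a <= s -> s <= r -> r <= b ->
  oriented_integral a f s r = \int[mu]_(t in `]s, r]) f t.
Proof.
move=> intf as_ sr rb; apply: Rintegral_itvB; rewrite ?bnd_simp//.
apply: integrable_sub_itv intf => t /=; rewrite !in_itv/= => /andP[-> /le_trans].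
exact.
Qed.

Lemma oriented_integralD f g s r : mu.-integrable I (EFin \o f) ->
  mu.-integrable I (EFin \o g) -> s \in `[a, b] -> r \in `[a, b] ->
  oriented_integral a (f \+ g) s r =
  oriented_integral a f s r + oriented_integral a g s r.
Proof.
move=> intf intg; rewrite !in_itv/= => /andP[_ sb] /andP[_ rb].
have sub h t : t <= b -> mu.-integrable I (EFin \o h) ->
    mu.-integrable `[a, t] (EFin \o h).
  move=> tb; apply: integrable_sub_itv => u /=.
  by rewrite !in_itv/= => /andP[-> /le_trans]; exact.
rewrite /oriented_integral !RintegralD//; try exact: sub.
by ring.
Qed.

Lemma oriented_integralZ f k s r : mu.-integrable I (EFin \o f) ->
  s \in `[a, b] -> r \in `[a, b] ->
  oriented_integral a (fun t => k * f t) s r = k * oriented_integral a f s r.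
Proof.
move=> intf; rewrite !in_itv/= => /andP[_ sb] /andP[_ rb].
have sub h t : t <= b -> mu.-integrable I (EFin \o h) ->
    mu.-integrable `[a, t] (EFin \o h).
  move=> tb; apply: integrable_sub_itv => u /=.
  by rewrite !in_itv/= => /andP[-> /le_trans]; exact.
rewrite /oriented_integral !RintegralZl//; try exact: sub.
by ring.
Qed.

Lemma oriented_integralB f g s r : mu.-integrable I (EFin \o f) ->
  mu.-integrable I (EFin \o g) -> s \in `[a, b] -> r \in `[a, b] ->
  oriented_integral a (f \- g) s r =
  oriented_integral a f s r - oriented_integral a g s r.
Proof.
move=> intf intg; rewrite !in_itv/= => /andP[_ sb] /andP[_ rb].
have sub h t : t <= b -> mu.-integrable I (EFin \o h) ->
    mu.-integrable `[a, t] (EFin \o h).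
  move=> tb; apply: integrable_sub_itv => u /=.
  by rewrite !in_itv/= => /andP[-> /le_trans]; exact.
rewrite /oriented_integral !RintegralB//; try exact: sub.
by ring.
Qed.

Lemma oriented_integral_cst k s r : s \in `[a, b] -> r \in `[a, b] ->
  oriented_integral a (cst k) s r = k * (r - s).
Proof.
rewrite !in_itv/= => /andP[as_ sb] /andP[ar rb].
have E u : a <= u -> \int[mu]_(t in `[a, u]) cst k t = k * (u - a).
  move=> au; rewrite Rintegral_cst//; congr (_ * _).
  have -> : u - a = fine (mu `[a, u]).
    rewrite lebesgue_measure_itv/= lte_fin.
    by move: au; rewrite le_eqVlt => /predU1P[->|->//]; rewrite ltxx subrr.
  by [].
by rewrite /oriented_integral !E//; ring.
Qed.

(** The absolute value on the right absorbs the orientation: for [r < s] the integral of the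
    nonnegative majorant counts negatively. Exchanging the endpoints reduces to [s <= r]. *)
Lemma le_norm_oriented_integral f g s r : mu.-integrable I (EFin \o f) ->
  mu.-integrable I (EFin \o g) -> s \in `[a, b] -> r \in `[a, b] ->
  (forall t, between s r t -> `|f t| <= g t) ->
  `|oriented_integral a f s r| <= `|oriented_integral a g s r|.
Proof.
move=> intf intg; wlog sr : s r / s <= r.
  move=> H; have [sr|/ltW rs] := leP s r; first exact: H.
  move=> sI rI fg; rewrite (oriented_integralC a f r) (oriented_integralC a g r).
  rewrite !normrN; apply: H => // t.
  by rewrite /between minC maxC; exact: fg.
rewrite !in_itv/= => /andP[as_ sb] /andP[ar rb] fg.
have sub h : mu.-integrable I (EFin \o h) ->
    mu.-integrable `]s, r] (EFin \o h).
  apply: integrable_sub_itv => u /=.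
  rewrite !in_itv/= => /andP[su ur].
  by rewrite (le_trans as_ (ltW su)) (le_trans ur).
rewrite !oriented_integral_le//.
have fg' t : `]s, r]%classic t -> `|f t| <= g t.
  rewrite /= in_itv/= => /andP[st tr]; apply: fg.
  by rewrite /between (min_idPl sr) (max_idPr sr) (ltW st).
rewrite (le_trans (le_normr_Rintegral _ _))//; first exact: sub.
rewrite [leRHS]ger0_norm; last first.
  by apply: Rintegral_ge0 => t /fg'; exact: le_trans.
apply: le_Rintegral => //; last exact: sub.
apply: (@integrable_sub_itv (Num.norm \o f)); last exact: integrable_norm.
move=> u /=; rewrite !in_itv/= => /andP[su ur].
by rewrite (le_trans as_ (ltW su)) (le_trans ur).
Qed.

Lemma norm_oriented_integral_le f s r : mu.-integrable I (EFin \o f) ->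
  s \in `[a, b] -> r \in `[a, b] ->
  `|oriented_integral a f s r| <= \int[mu]_(t in I) `|f t|.
Proof.
move=> intf; wlog sr : s r / s <= r.
  move=> H; have [sr|/ltW rs] := leP s r; first exact: H.
  by move=> sI rI; rewrite oriented_integralC normrN; exact: H.
rewrite !in_itv/= => /andP[as_ sb] /andP[ar rb].
have sub : `]s, r]%classic `<=` I.
  move=> u /=; rewrite !in_itv/= => /andP[su ur].
  by rewrite (le_trans as_ (ltW su)) (le_trans ur).
rewrite oriented_integral_le// (le_trans (le_normr_Rintegral _ _))//.
  exact: integrable_sub_itv intf.
have intnf : mu.-integrable I (EFin \o (Num.norm \o f)) by exact: integrable_norm.
rewrite /Rintegral fine_le//.
- by apply: integrable_fin_num => //; exact: integrable_sub_itv intnf.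
- exact: integrable_fin_num.
- by apply: ge0_subset_integral => //; case/integrableP : intnf.
Qed.

Lemma norm_oriented_integral_le_cst f M s r : mu.-integrable I (EFin \o f) ->
  s \in `[a, b] -> r \in `[a, b] ->
  (forall t, between s r t -> `|f t| <= M) ->
  `|oriented_integral a f s r| <= M * `|r - s|.
Proof.
move=> intf sI rI fM.
have M0 : 0 <= M.
  apply: le_trans (fM s _); first exact: normr_ge0.
  by rewrite /between ge_min lexx le_max lexx.
have := le_norm_oriented_integral intf (integrable_itv_cst M) sI rI fM.
by rewrite oriented_integral_cst// normrM (ger0_norm M0).
Qed.

Lemma oriented_integral_continuous f s : mu.-integrable I (EFin \o f) ->
  a <= b -> {within I, continuous (oriented_integral a f s)}.
Proof.
move=> intf ab; apply: within_continuousB; last by move=> x; exact: cvg_cst.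
exact: (parameterized_integral_continuous ab intf).
Qed.

(** The error of the difference quotient is the mean of [f - f x] between [x] and [y], which is
    small as soon as [f] is continuous at the single point [x]. Elsewhere integrability suffices, as
    needed for a coefficient that may be unbounded near the base point. *)
Lemma has_derive_within_oriented_integral f s x :
  mu.-integrable I (EFin \o f) -> x \in `[a, b] ->
  f y @[y --> within I (nbhs x)] --> f x ->
  has_derive_within I (oriented_integral a f s) x (f x).
Proof.
move=> intf xI fx; apply/cvgrPdist_le => e e0.
have /cvgrPdist_le/(_ _ e0)/near_withinP[d d0 dP] := fx.
apply/near_within_dnbhsP; exists d => // y yI yx yd.
have yx0 : 0 < `|y - x| by rewrite normr_gt0 subr_eq0.
rewrite -(ler_pM2r yx0) -normrM mulrBl divfK ?subr_eq0//.
have -> : f x * (y - x) - (oriented_integral a f s y - oriented_integral a f s x)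
   = - oriented_integral a (f \- cst (f x)) x y.
  rewrite (oriented_integralB intf (integrable_itv_cst _))//.
  by rewrite oriented_integral_cst// /oriented_integral; ring.
rewrite normrN; apply: norm_oriented_integral_le_cst => //.
  have -> : EFin \o (f \- cst (f x)) = ((EFin \o f) \- (EFin \o cst (f x)))%E.
    by apply/funext.
  by apply: integrableB => //; exact: integrable_itv_cst.
move=> t xyt; rewrite distrC; apply: dP; first exact: (between_itv xI yI xyt).
exact: le_lt_trans (between_dist xyt) yd.
Qed.

End fixed_segment.
End oriented_integral.

(** * A Gronwall inequality with an exponential weight around a base point *)

Section gronwall.
Context {R : realType}.
Implicit Types (u w : R -> R) (a b s r t x k l M P Q : R).

Lemma has_derive_within_subset (D E : set R) u x l : D `<=` E ->
  has_derive_within E u x l -> has_derive_within D u x l.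
Proof.
move=> DE; apply: cvg_trans; apply: cvg_fmap2 => A.
move=> /near_within_dnbhsP[d d0 dA]; apply/near_within_dnbhsP.
by exists d => // y /DE; exact: dA.
Qed.

Lemma within_continuousP (D : set R) u : {within D, continuous u} <->
  forall x, D x -> u y @[y --> within D (nbhs x)] --> u x.
Proof. exact: subspace_continuousP. Qed.

Lemma is_derive_expR_affine k l s x :
  is_derive x 1 (fun t => k * expR (l * (t - s))) (k * (l * expR (l * (x - s)))).
Proof.
have h : is_derive x 1 (fun t => l * (t - s)) l.
  by apply: is_derive_eq; rewrite subr0 -[_ *: _]/(_ * _) mulr1.
have h2 : is_derive x 1 (expR \o (fun t => l * (t - s))) (expR (l * (x - s)) * l).
  exact: is_derive1_comp.
apply: (@is_derive_eq _ _ _ (k \*: (expR \o (fun t => l * (t - s))))).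
by rewrite -[_ *: _]/(_ * _) [expR _ * l]mulrC.
Qed.

Section fixed_segment.
Variables a b s : R.
Hypothesis sI : s \in `[a, b].
Local Notation I := (`[a, b]%classic : set R).

(** To the right of [s], the function [M / l * expR (l * (t - s))] has derivative at least [w], so
    its difference with [u] is monotone. To the left the same comparison is made with [- l] in the
    exponent. *)
Lemma le_increment_expR u w l M r : 0 < l -> r \in `[a, b] ->
  (forall x, x \in `[a, b] -> has_derive_within I u x (w x)) ->
  (forall x, x \in `[a, b] -> `|w x| <= M * expR (l * `|x - s|)) ->
  u r - u s <= M / l * expR (l * `|r - s|).
Proof.
move=> l0 rI uw wM.
have M0 : 0 <= M.
  by have := le_trans (normr_ge0 _) (wM _ sI); rewrite subrr normr0 mulr0 expR0 mulr1.
have Ml0 : 0 <= M / l by rewrite divr_ge0// ltW.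
have sub x y : x \in `[a, b] -> y \in `[a, b] -> `[x, y]%classic `<=` I.
  rewrite !in_itv/= => /andP[ax _] /andP[_ yb] z /=; rewrite !in_itv/=.
  by move=> /andP[/(le_trans ax)-> /le_trans]; exact.
pose F c e := (fun t => c * expR (e * (t - s))) : R -> R.
have dF D c e x : has_derive_within D (F c e) x (c * (e * expR (e * (x - s)))).
  exact/is_derive_has_derive_within/is_derive_expR_affine.
have [sr|/ltW rs] := leP s r.
- rewrite ger0_norm ?subr_ge0//.
  have dfx x : x \in `[s, r] ->
      has_derive_within `[s, r]%classic (F (M / l) l \- u) x (M / l * (l * expR (l * (x - s))) - w x).
    move=> xsr; apply: has_derive_withinB => //.
    by apply: (has_derive_within_subset (sub _ _ sI rI)); apply: uw; exact: sub xsr.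
  suff : (F (M / l) l \- u) s <= (F (M / l) l \- u) r.
    rewrite /F/= subrr mulr0 expR0 mulr1; lra.
  apply: (@has_derive_within_ge0 _ s r _ _ sr).
  + by move=> x xsr; apply: dfx; apply: subset_itv_oo_cc xsr.
  + move=> x xsr.
    have xI : x \in `[a, b] by apply: (sub _ _ sI rI); exact: subset_itv_oo_cc xsr.
    rewrite mulrA divfK ?gt_eqF// subr_ge0; apply: le_trans (ler_norm _) _.
    apply: le_trans (wM _ xI) _.
    by rewrite ger0_norm// subr_ge0; move: xsr; rewrite in_itv/= => /andP[/ltW].
  + apply/within_continuousP => x xsr; apply: has_derive_within_continuous.
    exact: dfx.
- rewrite ler0_norm ?subr_le0//.
  have dfx x : x \in `[r, s] ->
      has_derive_within `[r, s]%classic (u \- F (M / l) (- l)) x (w x - M / l * (- l * expR (- l * (x - s)))).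
    move=> xsr; apply: has_derive_withinB => //.
    by apply: (has_derive_within_subset (sub _ _ rI sI)); apply: uw; exact: sub xsr.
  suff : (u \- F (M / l) (- l)) r <= (u \- F (M / l) (- l)) s.
    rewrite /F/= subrr mulr0 expR0 mulr1 mulNr mulrN; lra.
  apply: (@has_derive_within_ge0 _ r s _ _ rs).
  + by move=> x xsr; apply: dfx; apply: subset_itv_oo_cc xsr.
  + move=> x xsr.
    have xI : x \in `[a, b] by apply: (sub _ _ rI sI); exact: subset_itv_oo_cc xsr.
    rewrite mulNr mulrN opprK mulrA divfK ?gt_eqF//.
    have := wM _ xI; rewrite (@ler0_norm _ (x - s)); last first.
      by rewrite subr_le0; move: xsr; rewrite in_itv/= => /andP[_ /ltW].
    by rewrite mulrN mulNr ler_norml => /andP[+ _]; lra.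
  + apply/within_continuousP => x xsr; apply: has_derive_within_continuous.
    exact: dfx.
Qed.

Lemma norm_increment_expR u w l M r : 0 < l -> r \in `[a, b] ->
  (forall x, x \in `[a, b] -> has_derive_within I u x (w x)) ->
  (forall x, x \in `[a, b] -> `|w x| <= M * expR (l * `|x - s|)) ->
  `|u r - u s| <= M / l * expR (l * `|r - s|).
Proof.
move=> l0 rI uw wM; rewrite ler_norml (le_increment_expR l0 rI uw wM) andbT.
rewrite -[leRHS]opprK lerN2.
have := @le_increment_expR (\- u) (\- w) l M r l0 rI; rewrite /= opprB opprK addrC.
apply=> x xI; first exact/has_derive_withinN/uw.
by rewrite normrN; exact: wM.
Qed.

(* In the norm weighted by [exp (- l * |t - s|)], integrating the bound on [w]
   from [s] gains a factor [1 / l]; the choice [l = 2 Q + 1] absorbs [Q]. *)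
Lemma gronwall_past u w P Q r : a <= b -> 0 <= P -> 0 <= Q -> r \in `[a, b] ->
  (forall x, x \in `[a, b] -> has_derive_within I u x (w x)) ->
  (forall x N, x \in `[a, b] ->
    (forall t, t \in `[a, b] -> `|t - s| <= `|x - s| -> `|u t| <= N) ->
    `|w x| <= P + Q * N) ->
  `|u r| <= 2 * (`|u s| + P) * expR ((2 * Q + 1) * `|r - s|).
Proof.
move=> ab P0 Q0 rI uw wPQ; have [l lE] : {l | l = 2 * Q + 1} by exists (2 * Q + 1).
rewrite -lE.
have l1 : 1 <= l by lra.
have l0 : 0 < l by lra.
pose v t := `|u t| * expR (- (l * `|t - s|)).
have [c cI vc] : exists2 c, c \in `[a, b] & forall t, t \in `[a, b] -> v t <= v c.
  apply: EVT_max => //; apply/within_continuousP => x xI.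
  apply: cvgM.
    apply: cvg_norm; apply: has_derive_within_continuous; exact: uw.
  apply: cvg_within_filter.
  apply: continuous_comp; last exact: continuous_expR.
  apply: cvgN; apply: cvgM; first exact: cvg_cst.
  by apply: cvg_norm; apply: cvgB; [exact: cvg_id|exact: cvg_cst].
have uv t : `|u t| = v t * expR (l * `|t - s|).
  by rewrite /v -mulrA -expRD addNr expR0 mulr1.
have v0 : 0 <= v c by rewrite mulr_ge0// expR_ge0.
have wM x : x \in `[a, b] -> `|w x| <= (P + Q * v c) * expR (l * `|x - s|).
  move=> xI.
  have e1 : 1 <= expR (l * `|x - s|) by rewrite -expR0 ler_expR mulr_ge0// ltW.
  (* The admissible [N] at [x] is the maximum of [v] times the exponential at [x]: at points no
     farther from [s] the exponential is no larger. *)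
  apply: le_trans (wPQ x (v c * expR (l * `|x - s|)) xI _) _.
    move=> t tI tx; rewrite uv ler_pM ?expR_ge0 ?vc//.
      by rewrite mulr_ge0// expR_ge0.
    by rewrite ler_expR ler_pM2l.
  by rewrite mulrDl mulrA lerD2r ler_peMr.
have vc_le : v c <= `|u s| + (P + Q * v c) / l.
  have H := norm_increment_expR l0 cI uw wM.
  rewrite -(ler_pM2r (expR_gt0 (l * `|c - s|))) -uv.
  have -> : u c = (u c - u s) + u s by rewrite subrK.
  rewrite (le_trans (ler_normD _ _))// mulrDl addrC lerD//.
  by rewrite ler_peMr// -expR0 ler_expR mulr_ge0// ltW.
have {}vc_le : v c <= 2 * (`|u s| + P).
  have h1 : P / l <= P by rewrite ler_pdivrMr// ler_peMr.
  have h2 : Q * v c / l <= v c / 2.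
    rewrite ler_pdivrMr// mulrAC ler_pdivlMr// lE.
    by nra.
  by move: vc_le; rewrite mulrDl; lra.
by rewrite uv ler_pM2r ?expR_gt0// (le_trans (vc _ rI)).
Qed.

End fixed_segment.
End gronwall.

(** * Sequences with geometrically decreasing steps *)

Section geometric_sequence.
Context {R : realType}.
Implicit Types (z : nat -> R) (M x : R).

Lemma le_geometric_half_le0 x M : (forall n, x <= M / 2 ^+ n) -> x <= 0.
Proof.
move=> xM; have h : geometric M (2^-1 : R) n @[n --> \oo] --> (0 : R).
  by apply: cvg_geometric; rewrite ger0_norm ?invr_ge0// invf_lt1 ?ltr1n.
rewrite -(cvg_lim _ h)//; apply: limr_ge; first by apply/cvg_ex; exists 0.
by apply: nearW => n; rewrite /geometric/= exprVn.
Qed.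

(** With [e n = 2 * M / 2 ^+ n], the sum of all step bounds from [n] on, [z - e] is nondecreasing
    and [z + e] is nonincreasing. Both tend to the limit of [z], which therefore lies within [e n]
    of [z n]. *)
Lemma geometric_step_cvg z M :
  (forall n, `|z n.+1 - z n| <= M / 2 ^+ n) ->
  z n @[n --> \oo] --> limn z /\ forall n, `|limn z - z n| <= 2 * M / 2 ^+ n.
Proof.
move=> zM.
pose e n : R := 2 * M / 2 ^+ n.
have eS n : e n = e n.+1 + M / 2 ^+ n.
  by rewrite /e exprS invfM; field; rewrite expf_neq0.
have M0 : 0 <= M.
  by have := le_trans (normr_ge0 _) (zM 0); rewrite expr0 divr1.
have e0 n : 0 <= e n by rewrite !mulr_ge0// invr_ge0 exprn_ge0.
have ndz : {homo (fun n => z n - e n) : n m / (n <= m)%N >-> n <= m}.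
  apply/nondecreasing_seqP => n.
  by have := zM n; rewrite ler_norml => /andP[h _]; rewrite /= (eS n); lra.
have niz : {homo (fun n => z n + e n) : n m / (n <= m)%N >-> m <= n}.
  apply/nonincreasing_seqP => n.
  by have := zM n; rewrite ler_norml => /andP[_ h]; rewrite /= (eS n); lra.
have ecvg : e n @[n --> \oo] --> (0 : R).
  have h : geometric (2 * M) (2^-1 : R) n @[n --> \oo] --> (0 : R).
    by apply: cvg_geometric; rewrite ger0_norm ?invr_ge0// invf_lt1 ?ltr1n.
  apply: cvg_trans h; apply: near_eq_cvg.
  by apply: nearW => n; rewrite /geometric/= exprVn.
have ubz : has_ubound (range (fun n => z n - e n)).
  exists (z 0 + e 0) => _ [n _ <-].
  by have := niz 0 n isT; have := e0 n; rewrite /=; lra.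
have cz := nondecreasing_is_cvgn ndz ubz.
have zl : z n @[n --> \oo] --> limn (fun n => z n - e n).
  rewrite -[limn _]addr0; apply: cvg_trans (cvgD cz ecvg).
  by apply: near_eq_cvg; apply: nearW => n /=; rewrite subrK.
have lE : limn z = limn (fun n => z n - e n) by exact: cvg_lim.
split; first by rewrite lE.
move=> n; rewrite ler_norml; apply/andP; split.
  by rewrite lerBrDl lE; exact: (nondecreasing_cvgn_le ndz cz).
rewrite lerBlDl lE.
have zel : z n + e n @[n --> \oo] --> limn (fun n => z n - e n).
  by rewrite -[limn _]addr0; exact: cvgD.
rewrite -[X in X <= _](cvg_lim _ zel)//; apply: (nonincreasing_cvgn_ge niz).
by apply/cvg_ex; eexists; exact: zel.
Qed.

End geometric_sequence.

(** * The problem [(p u')' = p q u] for an abstract weight [p] that may vanish only at [s] *)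

Section weighted_problem.
Context {R : realType}.
Implicit Types (q u v w : R -> R) (x r t k l M N B : R).
Variables (a b s : R) (p dp : R -> R) (K : R).
Local Notation I := (`[a, b]%classic : set R).
Local Notation mu := (@lebesgue_measure R).
Hypotheses (ab : a < b) (sI : s \in `[a, b]).
Hypothesis p_gt0 : forall x, x \in `[a, b] -> x != s -> 0 < p x.
Hypothesis ps_ge0 : 0 <= p s.
Hypothesis p_derive :
  forall x, x \in `[a, b] -> x != s -> has_derive_within I p x (dp x).
Hypothesis dp_continuous : forall x, x \in `[a, b] -> x != s ->
  dp y @[y --> within I (nbhs x)] --> dp x.
Hypothesis p_continuous_at : p y @[y --> within I (nbhs s)] --> p s.
Hypothesis K_ge1 : 1 <= K.
Hypothesis p_le : forall x t, x \in `[a, b] -> t \in `[a, b] ->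
  `|t - s| <= `|x - s| -> p t <= K * p x.

Let K_ge0 : 0 <= K. Proof. exact: le_trans K_ge1. Qed.

Lemma weight_ge0 x : x \in `[a, b] -> 0 <= p x.
Proof.
by move=> xI; have [->|/(p_gt0 xI)/ltW] := eqVneq x s.
Qed.

Lemma weight_continuous : {within I, continuous p}.
Proof.
apply/within_continuousP => x xI; have [->//|xs] := eqVneq x s.
by apply: has_derive_within_continuous; exact: p_derive.
Qed.

Lemma within_continuous_bounded u : {within I, continuous u} ->
  exists2 M, 0 <= M & forall x, x \in `[a, b] -> `|u x| <= M.
Proof.
move=> cu; have cnu : {within I, continuous (Num.norm \o u)}.
  move/within_continuousP : cu => cu.
  by apply/within_continuousP => x xI; apply: cvg_norm; exact: cu.
have [d dI ud] := EVT_max (ltW ab) cnu.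
by exists `|u d|.
Qed.

Lemma within_continuous_measurable u : {within I, continuous u} ->
  measurable_fun I u.
Proof. exact: subspace_continuous_measurable_fun. Qed.

Lemma integrable_coef q v B : mu.-integrable I (EFin \o q) ->
  measurable_fun I v -> (forall x, x \in `[a, b] -> `|v x| <= B) ->
  mu.-integrable I (EFin \o (fun t => p t * q t * v t)).
Proof.
move=> intq mv vB; have mp := within_continuous_measurable weight_continuous.
have [M M0 pM] := within_continuous_bounded weight_continuous.
have -> : EFin \o (fun t => p t * q t * v t) =
    ((EFin \o (p \* v)%R) \* (EFin \o q))%E.
  by apply/funext => t /=; rewrite -EFinM mulrAC.
apply: integrableMr => //; first exact: measurable_funM.
exists (M * B); split; first exact: num_real.
move=> k Mk x xI; apply: le_trans _ (ltW Mk); rewrite normrM.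
by apply: ler_pM => //; [exact: pM|exact: vB].
Qed.

(** Between [s] and [x] the weight is at most [K * p x], so it leaves the integral and will cancel
    on division by [p x]. The integral of [|q|] is kept local, from [s] to [x]: its tending to zero
    at [s] later gives continuity of the slope there. *)
Lemma le_norm_weighted_integral f q x N : 0 <= N -> mu.-integrable I (EFin \o f) ->
  mu.-integrable I (EFin \o q) -> x \in `[a, b] ->
  (forall t, between s x t -> `|f t| <= p t * N * `|q t|) ->
  `|oriented_integral a f s x| <=
    K * p x * N * `|oriented_integral a (Num.norm \o q) s x|.
Proof.
move=> N0 intf intq xI fpq.
have intnq := integrable_norm intq.
have KpN0 : 0 <= K * p x * N by rewrite !mulr_ge0// weight_ge0.
rewrite -[X in X * _]ger0_norm// -normrM -(oriented_integralZ _ intnq sI xI).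
apply: (le_norm_oriented_integral intf _ sI xI).
  have -> : EFin \o (fun t => K * p x * N * (Num.norm \o q) t) =
      (fun t => ((K * p x * N)%:E * (EFin \o (Num.norm \o q)) t)%E).
    by apply/funext => t /=; rewrite EFinM.
  exact: integrableZl.
move=> t st; rewrite (le_trans (fpq _ st))//= ler_wpM2r// ler_wpM2r// p_le//.
  exact: (between_itv sI xI st).
exact: between_dist.
Qed.

Lemma le_weighted_integral f q x N : 0 <= N -> mu.-integrable I (EFin \o f) ->
  mu.-integrable I (EFin \o q) -> x \in `[a, b] ->
  (forall t, between s x t -> `|f t| <= p t * N * `|q t|) ->
  `|oriented_integral a f s x| <= p x * (K * N * \int[mu]_(t in I) `|q t|).
Proof.
move=> N0 intf intq xI fpq.
rewrite (le_trans (le_norm_weighted_integral N0 intf intq xI fpq))//.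
have -> : p x * (K * N * \int[mu]_(t in I) `|q t|) =
  K * p x * N * \int[mu]_(t in I) `|q t| by ring.
apply: ler_wpM2l; first by rewrite !mulr_ge0// weight_ge0.
have := norm_oriented_integral_le (integrable_norm intq) sI xI.
by under eq_Rintegral do rewrite /= normr_id.
Qed.

(* [w] stands for [u'] and the equation is [(p u')' = p q u] integrated from
   [s]. At a point where [p] vanishes the integrated equation is void, which
   is why [w s = c] is recorded separately. *)
Definition weighted_solution q b0 c u w : Prop :=
  [/\ forall x, x \in `[a, b] -> has_derive_within I u x (w x),
      u s = b0, w s = c &
      forall x, x \in `[a, b] -> p x * w x =
        p s * c + oriented_integral a (fun t => p t * q t * u t) s x].

(** The open segment between [x] and [s] does not contain [s], so the mean value argument applies on
    it, to [f] and to [- f]; continuity of [f] at [s] makes the endpoint value count. *)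
Lemma derive_within_eq0_cst f : {within I, continuous f} ->
  (forall x, x \in `[a, b] -> x != s -> has_derive_within I f x 0) ->
  forall x, x \in `[a, b] -> f x = f s.
Proof.
move=> cf f0.
have mono g x y : {within I, continuous g} ->
    (forall x, x \in `[a, b] -> x != s -> has_derive_within I g x 0) ->
    x \in `[a, b] -> y \in `[a, b] -> x <= y -> s \notin `]x, y[ -> g x <= g y.
  move=> cg g0 xI yI xy sxy.
  have sub : `[x, y]%classic `<=` I.
    move=> z /=; move: xI yI; rewrite !in_itv/= => /andP[ax _] /andP[_ yb].
    by move=> /andP[/(le_trans ax)-> /le_trans]; exact.
  apply: (@has_derive_within_ge0 _ x y g (cst 0) xy) => //.
  - move=> z zxy; apply: (has_derive_within_subset sub); apply: g0.
      exact/sub/subset_itv_oo_cc.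
    by apply: contraNneq sxy => <-.
  - exact: (continuous_subspaceW sub).
have eqxy x y : x \in `[a, b] -> y \in `[a, b] -> x <= y -> s \notin `]x, y[ ->
    f x = f y.
  move=> xI yI xy sxy; apply/eqP; rewrite eq_le mono//=.
  rewrite -lerN2; apply: (mono (\- f)) => //.
    by move=> z; apply: cvgN; exact: cf.
  by move=> z zI zs; rewrite -oppr0; apply: has_derive_withinN; exact: f0.
move=> x xI; have [xs|/ltW sx] := leP x s.
  by apply: eqxy; rewrite // in_itv/= ltxx andbF.
by apply/esym; apply: eqxy; rewrite // in_itv/= ltxx.
Qed.

(** Passage from the differential to the integrated equation: [p w] minus the integral has zero
    derivative off [s] and is continuous, so it keeps its value [p s * c] from [s]. *)
Lemma weighted_solution_of_derive q b0 c u w : mu.-integrable I (EFin \o q) ->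
  (forall x, x \in `[a, b] -> x != s ->
    q y @[y --> within I (nbhs x)] --> q x) ->
  (forall x, x \in `[a, b] -> has_derive_within I u x (w x)) ->
  {within I, continuous w} -> u s = b0 -> w s = c ->
  (forall x, x \in `[a, b] -> x != s ->
    has_derive_within I (p \* w) x (p x * q x * u x)) ->
  weighted_solution q b0 c u w.
Proof.
move=> intq cq uw cw us ws pw; split=> // x xI.
have cu : {within I, continuous u}.
  by apply/within_continuousP => y yI; apply: has_derive_within_continuous; exact: uw.
have [B B0 uB] := within_continuous_bounded cu.
have mu_ := within_continuous_measurable cu.
have intf := integrable_coef intq mu_ uB.
set f := (fun t => p t * q t * u t) in intf *.
pose g := (p \* w) \- oriented_integral a f s.
have cg : {within I, continuous g}.
  apply: within_continuousB; last exact: oriented_integral_continuous (ltW ab).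
  apply/within_continuousP => y yI; apply: cvgM.
    by move/within_continuousP : weight_continuous; exact.
  by move/within_continuousP : cw; exact.
have : g x = g s.
  apply: derive_within_eq0_cst => // y yI ys.
  rewrite -(subrr (f y)); apply: has_derive_withinB; first exact: pw.
  apply: has_derive_within_oriented_integral => //.
  apply: cvgM; first apply: cvgM.
  - by move/within_continuousP : weight_continuous; exact.
  - exact: cq.
  - by move/within_continuousP : cu; exact.
rewrite /g/= oriented_integral_id subr0 ws => /eqP.
by rewrite subr_eq => /eqP.
Qed.

Lemma weighted_solution_continuous q b0 c u w : weighted_solution q b0 c u w ->
  {within I, continuous u}.
Proof.
move=> [uw _ _ _].
by apply/within_continuousP => y yI; apply: has_derive_within_continuous; exact: uw.
Qed.

Lemma weighted_solution_integrable q b0 c u w : mu.-integrable I (EFin \o q) ->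
  weighted_solution q b0 c u w ->
  mu.-integrable I (EFin \o (fun t => p t * q t * u t)).
Proof.
move=> intq /weighted_solution_continuous cu.
have [B B0 uB] := within_continuous_bounded cu.
exact: integrable_coef (within_continuous_measurable cu) uB.
Qed.

(** Gronwall with [P = K * |c|] and [Q = K] times the norm of [q]. A bound by the data alone is
    wanted because the size of [u] multiplies the coefficient difference in the stability
    estimate. *)
Lemma weighted_solution_bound q b0 c u w r : mu.-integrable I (EFin \o q) ->
  weighted_solution q b0 c u w -> r \in `[a, b] ->
  `|u r| <= 2 * (`|b0| + K * `|c|) *
    expR ((2 * (K * \int[mu]_(t in I) `|q t|) + 1) * `|r - s|).
Proof.
move=> intq solu rI; set A := \int[mu]_(t in I) `|q t|; have intf := weighted_solution_integrable intq solu.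
have [uw us ws wE] := solu.
have A0 : 0 <= A by exact: Rintegral_ge0.
rewrite -us; apply: (gronwall_past sI (ltW ab) _ _ rI uw).
- by rewrite mulr_ge0.
- by rewrite mulr_ge0.
move=> x N xI uN; have N0 : 0 <= N.
  by apply: le_trans (uN s sI _); rewrite ?normr_ge0// subrr normr0.
(* Division by the weight is safe only off [s]; at [s] the bound comes from [w s = c] and
   [1 <= K]. *)
have [->|xs] := eqVneq x s.
  by rewrite ws ler_wpDr ?mulr_ge0// ler_peMl.
rewrite -(ler_pM2l (p_gt0 xI xs)) -[X in X * `|_|](gtr0_norm (p_gt0 xI xs)).
rewrite -normrM wE// (le_trans (ler_normD _ _))// mulrDr lerD//.
  rewrite normrM ger0_norm// mulrA ler_wpM2r// mulrC p_le//.
  by rewrite subrr normr0.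
have -> : K * A * N = K * N * A by ring.
apply: le_weighted_integral => // t sxt.
rewrite normrM normrM ger0_norm ?weight_ge0 ?(between_itv sI xI sxt)//.
rewrite mulrAC; apply: ler_wpM2r => //; apply: ler_wpM2l.
  by rewrite weight_ge0// (between_itv sI xI sxt).
by rewrite uN ?between_dist// (between_itv sI xI sxt).
Qed.

(** The data being shared, the difference starts from zero, and Gronwall applies with
    [P = K * B * D] and [Q = K * A]. Both bounds are linear in [D]; equal coefficients give [D = 0],
    hence uniqueness. *)
Lemma weighted_solution_stable q1 q2 b0 c u1 u2 w1 w2 A B r :
  mu.-integrable I (EFin \o q1) -> mu.-integrable I (EFin \o q2) ->
  weighted_solution q1 b0 c u1 w1 -> weighted_solution q2 b0 c u2 w2 ->
  (forall x, x \in `[a, b] -> `|u1 x| <= B) ->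
  \int[mu]_(t in I) `|q2 t| <= A -> r \in `[a, b] ->
  let D := \int[mu]_(t in I) `|(q2 \- q1) t| in
  let E := 2 * (K * B * D) * expR ((2 * (K * A) + 1) * (b - a)) in
  `|u2 r - u1 r| <= E /\ `|w2 r - w1 r| <= K * B * D + K * A * E.
Proof.
move=> intq1 intq2 sol1 sol2 u1B q2A rI D E.
have intf1 := weighted_solution_integrable intq1 sol1.
have intf2 := weighted_solution_integrable intq2 sol2.
have cu1 := weighted_solution_continuous sol1.
have cu2 := weighted_solution_continuous sol2.
have [uw1 us1 ws1 wE1] := sol1; have [uw2 us2 ws2 wE2] := sol2.
have A0 : 0 <= A by apply: le_trans q2A; exact: Rintegral_ge0.
have D0 : 0 <= D by exact: Rintegral_ge0.
have B0 : 0 <= B by exact: le_trans (u1B s sI).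
have intq : mu.-integrable I (EFin \o (q2 \- q1)).
  have -> : EFin \o (q2 \- q1) = ((EFin \o q2) \- (EFin \o q1))%E by exact/funext.
  exact: integrableB.
have cd : {within I, continuous (u2 \- u1)} by exact: within_continuousB.
have [d d0 dB] := within_continuous_bounded cd.
have intg1 := integrable_coef intq (within_continuous_measurable cu1) u1B.
have intg2 := integrable_coef intq2 (within_continuous_measurable cd) dB.
have dw x N : x \in `[a, b] ->
    (forall t, t \in `[a, b] -> `|t - s| <= `|x - s| -> `|(u2 \- u1) t| <= N) ->
    `|(w2 \- w1) x| <= K * B * D + K * A * N.
  move=> xI uN; have N0 : 0 <= N.
    by apply: le_trans (uN s sI _); rewrite ?normr_ge0// subrr normr0.
  have [->|xs] := eqVneq x s.
    by rewrite /= ws1 ws2 subrr normr0 addr_ge0// !mulr_ge0.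
  rewrite -(ler_pM2l (p_gt0 xI xs)) -[X in X * `|_|](gtr0_norm (p_gt0 xI xs)).
  rewrite -normrM /= mulrBr wE1// wE2// opprD addrACA subrr add0r.
  rewrite -(oriented_integralB intf2 intf1)//.
  (* The coefficient difference is paired with [u1], already bounded by [B], and acts as a source;
     the unknown difference is paired with [q2], whose norm is at most [A]. *)
  have -> : (fun t => p t * q2 t * u2 t) \- (fun t => p t * q1 t * u1 t) =
      (fun t => p t * (q2 \- q1) t * u1 t) \+ (fun t => p t * q2 t * (u2 \- u1) t).
    by apply/funext => t /=; ring.
  rewrite (oriented_integralD intg1 intg2)// (le_trans (ler_normD _ _))//.
  rewrite mulrDr lerD//.
    apply: le_weighted_integral => // t sxt.
    have tI := between_itv sI xI sxt.
    rewrite normrM normrM ger0_norm ?weight_ge0// mulrAC.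
    by apply: ler_wpM2r => //; apply: ler_wpM2l; rewrite ?weight_ge0// u1B.
  have q2N : p x * (K * N * \int[mu]_(t in I) `|q2 t|) <= p x * (K * A * N).
    by rewrite ler_wpM2l ?weight_ge0// mulrAC ler_wpM2r// ler_wpM2l.
  apply: le_trans q2N; apply: le_weighted_integral => // t sxt.
  have tI := between_itv sI xI sxt.
  rewrite normrM normrM ger0_norm ?weight_ge0// mulrAC.
  by apply: ler_wpM2r => //; apply: ler_wpM2l; rewrite ?weight_ge0// uN// between_dist.
have dE x : x \in `[a, b] -> `|(u2 \- u1) x| <= E.
  move=> xI.
  have := @gronwall_past _ a b s sI (u2 \- u1) (w2 \- w1) (K * B * D) (K * A) x
    (ltW ab).
  rewrite /= us1 us2 subrr normr0 add0r => h.
  apply: le_trans (h _ _ xI _ dw) _ => {h}.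
  - by rewrite !mulr_ge0.
  - by rewrite !mulr_ge0.
  - by move=> y yI; apply: has_derive_withinB; [exact: uw2|exact: uw1].
  rewrite ler_wpM2l ?ler_expR//; first by rewrite !mulr_ge0.
  rewrite ler_wpM2l//; first by rewrite addr_ge0// !mulr_ge0.
  exact: itv_dist_le.
by split; [exact: dE|apply: dw => // t tI _; exact: dE].
Qed.

(** * Existence by Picard iteration *)

Section existence.
Variables (q : R -> R) (b0 c : R).
Hypothesis intq : mu.-integrable I (EFin \o q).
Hypothesis pc : 0 < p s \/ c = 0.
Local Notation A := (\int[mu]_(t in I) `|q t|).

Definition weighted_slope u x : R :=
  (p s * c + oriented_integral a (fun t => p t * q t * u t) s x) / p x.

Definition picard u x : R := b0 + oriented_integral a (weighted_slope u) s x.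

(** If the weight vanishes at [s], then [c = 0] by [pc]; the numerator is zero and the quotient
    still returns the prescribed slope. *)
Lemma weighted_slope_at u : weighted_slope u s = c.
Proof.
rewrite /weighted_slope oriented_integral_id addr0.
by have [ps0|->] := pc; [rewrite mulrAC divff ?mul1r// gt_eqF|rewrite mulr0 mul0r].
Qed.

Lemma mul_weighted_slope u x : x \in `[a, b] -> p x * weighted_slope u x =
  p s * c + oriented_integral a (fun t => p t * q t * u t) s x.
Proof.
move=> xI; have [->|xs] := eqVneq x s.
  by rewrite weighted_slope_at oriented_integral_id addr0.
by rewrite /weighted_slope mulrC divfK// gt_eqF// p_gt0.
Qed.

Section bounded_argument.
Variables (u : R -> R) (B : R).
Hypothesis mu_u : measurable_fun I u.
Hypothesis uB : forall x, x \in `[a, b] -> `|u x| <= B.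

Let intf := integrable_coef intq mu_u uB.

(** The delicate point is [s] when [p s = 0]. There [c = 0], and after cancelling the weight the
    slope at [y] is at most [K * B] times the integral of [|q|] between [s] and [y], which tends to
    zero. *)
Lemma weighted_slope_continuous : {within I, continuous (weighted_slope u)}.
Proof.
apply/within_continuousP => x xI.
have [px0|px0] := ltP 0 (p x).
  apply: cvgM.
    apply: cvgD; first exact: cvg_cst.
    by move/within_continuousP : (oriented_integral_continuous (s := s) intf (ltW ab)); exact.
  apply: cvgV; first by rewrite gt_eqF.
  by move/within_continuousP : weight_continuous; exact.
have xs : x = s by apply: contraTeq px0 => xs; rewrite -ltNge p_gt0.
subst x.
have c0 : c = 0 by have [|//] := pc; rewrite ltNge px0.
rewrite weighted_slope_at c0.
have B0 : 0 <= B by exact: le_trans (uB sI).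
pose h y := K * B * `|oriented_integral a (Num.norm \o q) s y|.
have h0 : h y @[y --> within I (nbhs s)] --> (0 : R).
  have -> : (0 : R) = h s by rewrite /h oriented_integral_id normr0 mulr0.
  apply: cvgM; first exact: cvg_cst.
  apply: cvg_norm.
  have := oriented_integral_continuous (s := s) (integrable_norm intq) (ltW ab).
  by move/within_continuousP; exact.
have hN0 : - h y @[y --> within I (nbhs s)] --> (0 : R).
  by rewrite -oppr0; exact: cvgN.
apply: (squeeze_cvgr _ hN0 h0); apply/near_withinP; exists 1 => // y yI _.
rewrite -ler_norml; have [->|ys] := eqVneq y s.
  by rewrite weighted_slope_at c0 normr0 /h !mulr_ge0.
have py0 := p_gt0 yI ys.
rewrite /weighted_slope c0 mulr0 add0r normrM normfV (gtr0_norm py0).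
rewrite ler_pdivrMr//.
have -> : h y * p y =
  K * p y * B * `|oriented_integral a (Num.norm \o q) s y| by rewrite /h; ring.
apply: le_norm_weighted_integral => // t sxt; have tI := between_itv sI yI sxt.
rewrite normrM normrM ger0_norm ?weight_ge0// mulrAC.
by apply: ler_wpM2r => //; apply: ler_wpM2l; rewrite ?weight_ge0// uB.
Qed.

Lemma has_derive_within_picard x : x \in `[a, b] ->
  has_derive_within I (picard u) x (weighted_slope u x).
Proof.
move=> xI; rewrite -[weighted_slope u x]add0r.
apply: has_derive_withinD; first exact: has_derive_within_cst.
have cs := weighted_slope_continuous.
apply: has_derive_within_oriented_integral => //.
  by apply: continuous_compact_integrable; first exact: segment_compact.
by move/within_continuousP : cs; exact.
Qed.

Lemma picard_continuous : {within I, continuous (picard u)}.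
Proof.
apply/within_continuousP => x xI; apply: has_derive_within_continuous.
exact: has_derive_within_picard.
Qed.

Lemma picard_at : picard u s = b0.
Proof. by rewrite /picard oriented_integral_id addr0. Qed.

(** Supplies the second derivative of the solution off [s], in a form whose continuity can be read
    off. *)
Lemma has_derive_within_weighted_slope x : x \in `[a, b] -> x != s ->
  q y @[y --> within I (nbhs x)] --> q x ->
  u y @[y --> within I (nbhs x)] --> u x ->
  has_derive_within I (weighted_slope u) x
    (p x * q x * u x / p x - weighted_slope u x * dp x / p x).
Proof.
move=> xI xs qx ux; have px0 := p_gt0 xI xs.
have -> : p x * q x * u x / p x - weighted_slope u x * dp x / p x =
    (0 + p x * q x * u x) * (p x)^-1 +
    (p s * c + oriented_integral a (fun t => p t * q t * u t) s x) *
      (- dp x / p x ^+ 2).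
  by rewrite /weighted_slope; field; rewrite gt_eqF.
apply: has_derive_withinM; last first.
  by apply: has_derive_withinV; [rewrite gt_eqF|exact: p_derive].
apply: has_derive_withinD; first exact: has_derive_within_cst.
apply: has_derive_within_oriented_integral => //.
apply: cvgM => //; apply: cvgM => //.
by move/within_continuousP : weight_continuous; exact.
Qed.

End bounded_argument.

Lemma picard_contract u v B1 B2 l M r :
  measurable_fun I u -> (forall x, x \in `[a, b] -> `|u x| <= B1) ->
  measurable_fun I v -> (forall x, x \in `[a, b] -> `|v x| <= B2) ->
  0 < l -> 0 <= M ->
  (forall x, x \in `[a, b] -> `|u x - v x| <= M * expR (l * `|x - s|)) ->
  r \in `[a, b] ->
  `|picard u r - picard v r| <= K * A * M / l * expR (l * `|r - s|).
Proof.
move=> mu_u uB mu_v vB l0 M0 uvM rI.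
have intu := integrable_coef intq mu_u uB.
have intv := integrable_coef intq mu_v vB.
have A0 : 0 <= A by exact: Rintegral_ge0.
have := @norm_increment_expR _ a b s sI (picard u \- picard v)
  (weighted_slope u \- weighted_slope v) l (K * A * M) r l0 rI.
rewrite /= (picard_at u) (picard_at v) (subrr b0) subr0; apply.
  move=> x xI.
  by apply: has_derive_withinB; apply: has_derive_within_picard; eassumption.
move=> x xI; have [->|xs] := eqVneq x s.
  by rewrite !weighted_slope_at !subrr !normr0 !mulr_ge0// expR_ge0.
rewrite -(ler_pM2l (p_gt0 xI xs)) -[X in X * `|_|](gtr0_norm (p_gt0 xI xs)).
rewrite -normrM mulrBr !mul_weighted_slope// opprD addrACA subrr add0r.
rewrite -(oriented_integralB intu intv)//.
have -> : K * A * M * expR (l * `|x - s|) = K * (M * expR (l * `|x - s|)) * A.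
  by ring.
apply: le_weighted_integral => //.
- by rewrite mulr_ge0// expR_ge0.
- have -> : EFin \o ((fun t => p t * q t * u t) \- (fun t => p t * q t * v t))%R =
    ((EFin \o (fun t => p t * q t * u t)%R) \-
     (EFin \o (fun t => p t * q t * v t)%R))%E by exact/funext.
  exact: integrableB.
move=> t sxt; have tI := between_itv sI xI sxt.
rewrite /= -mulrBr normrM normrM ger0_norm ?weight_ge0// mulrAC.
apply: ler_wpM2r => //; apply: ler_wpM2l; first by rewrite weight_ge0.
rewrite (le_trans (uvM _ tI))//; apply: ler_wpM2l => //.
by rewrite ler_expR ler_pM2l// between_dist.
Qed.

(** The iterates converge pointwise at a geometric rate, so no complete function space is involved.
    Measurability and boundedness of the limit are enough: continuity follows afterwards, since
    [picard] maps such functions to continuous ones. *)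
Lemma picard_fixpoint : exists2 u : R -> R, measurable_fun I u &
  (exists B, forall x, x \in `[a, b] -> `|u x| <= B) /\
  forall x, x \in `[a, b] -> picard u x = u x.
Proof.
have A0 : 0 <= A by exact: Rintegral_ge0.
(* [lra] fails on the integral [A] unless it is generalized to a variable. *)
move: A A0 (@picard_contract) => A A0 contract.
have [l lE] : {l | l = 2 * (K * A) + 1} by exists (2 * (K * A) + 1).
have KA0 : 0 <= K * A by rewrite mulr_ge0.
have l0 : 0 < l by lra.
pose E x := expR (l * `|x - s|).
have E0 x : 0 < E x by exact: expR_gt0.
have E1 x : 1 <= E x by rewrite -expR0 ler_expR mulr_ge0// ltW.
have Emax x : x \in `[a, b] -> E x <= expR (l * (b - a)).
  by move=> xI; rewrite ler_expR ler_pM2l//; exact: itv_dist_le.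
(* The choice [l = 2 * (K * A) + 1] makes the contraction factor [K * A / l] at most one half. *)
have half M : 0 <= M -> K * A * M / l <= M / 2.
  move=> M0; rewrite ler_pdivrMr// [leRHS]mulrAC ler_pdivlMr// lE; nra.
pose z n := iter n picard (cst b0).
have cz n : {within I, continuous (z n)}.
  elim: n => [|n cz]; first by move=> x; exact: cvg_cst.
  have [B _ zB] := within_continuous_bounded cz.
  exact: picard_continuous (within_continuous_measurable cz) zB.
have mz n := within_continuous_measurable (cz n).
have bz n := within_continuous_bounded (cz n).
have [N N0 zN] : exists2 N, 0 <= N & forall x, x \in `[a, b] -> `|z 1 x - z 0 x| <= N.
  have [N N0 zN] := bz 1; exists (N + `|b0|); first by rewrite addr_ge0.
  by move=> x xI; rewrite (le_trans (ler_normB _ _))// lerD// zN.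
have stepz n x : x \in `[a, b] -> `|z n.+1 x - z n x| <= N / 2 ^+ n * E x.
  elim: n x => [|n IH] x xI.
    by rewrite expr0 divr1 (le_trans (zN _ xI))// ler_peMr.
  have [B1 _ zB1] := bz n.+1; have [B2 _ zB2] := bz n.
  have Nn : 0 <= N / 2 ^+ n by rewrite divr_ge0// exprn_ge0.
  rewrite (le_trans (contract _ _ _ _ _ _ _ (mz _) zB1 (mz _) zB2 l0 Nn IH xI))//.
  rewrite ler_pM2r ?expR_gt0// (le_trans (half _ Nn))//.
  by rewrite exprS invfM; lra.
pose u x := limn (z ^~ x).
have zu x : x \in `[a, b] -> z n x @[n --> \oo] --> u x /\
    forall n, `|u x - z n x| <= 2 * N / 2 ^+ n * E x.
  move=> xI; have [|zx ux] := @geometric_step_cvg _ (z ^~ x) (N * E x).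
    by move=> n; rewrite (le_trans (stepz _ _ xI))// mulrAC.
  split=> // n; rewrite (le_trans (ux n))//.
  by rewrite mulrA [leRHS]mulrAC.
have mu_u : measurable_fun I u.
  by apply: (measurable_fun_cvg mz) => x xI; have [] := zu x xI.
have [B uB] : exists B, forall x, x \in `[a, b] -> `|u x| <= B.
  exists (2 * N * expR (l * (b - a)) + `|b0|) => x xI.
  have [_ /(_ 0)] := zu x xI; rewrite expr0 divr1 => ux.
  rewrite -[u x](subrK b0) (le_trans (ler_normD _ _))// lerD2r.
  by rewrite (le_trans ux)// ler_wpM2l ?mulr_ge0// Emax.
exists u => //; split; first by exists B.
move=> x xI; apply/eqP; rewrite -subr_eq0 -normr_le0.
(* Compare [picard u x] and [u x] through [z n.+1 x = picard (z n) x]: each of the two distances is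
   at most [N / 2 ^+ n * E x], the first by contraction and the second by the rate of
   convergence. *)
apply: (@le_geometric_half_le0 _ _ (2 * N * E x)) => n.
have [B' _ zB'] := bz n.
have N2 : 0 <= 2 * N / 2 ^+ n by rewrite !mulr_ge0// invr_ge0 exprn_ge0.
have uz y : y \in `[a, b] -> `|u y - z n y| <= 2 * N / 2 ^+ n * E y.
  by move=> /zu[_]; exact.
have h1 := contract _ _ _ _ _ _ _ mu_u uB (mz n) zB' l0 N2 uz xI.
have [_ /(_ n.+1)] := zu x xI; rewrite -[z n.+1 x]/(picard (z n) x) => h2.
rewrite -(subrK (picard (z n) x) (picard u x)) -addrA (le_trans (ler_normD _ _))//.
rewrite [X in _ + X]distrC (le_trans (lerD h1 h2))// -/(E x) -mulrDl [leRHS]mulrAC.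
rewrite ler_pM2r// (le_trans (lerD (half _ N2) (lexx _)))//.
by rewrite exprS invfM; lra.
Qed.

Lemma weighted_solution_exists :
  (forall x, x \in `[a, b] -> x != s ->
    q y @[y --> within I (nbhs x)] --> q x) ->
  exists u w dw, [/\ weighted_solution q b0 c u w,
    {within I, continuous w},
    forall x, x \in `[a, b] -> x != s ->
      has_derive_within I (p \* w) x (p x * q x * u x),
    forall x, x \in `[a, b] -> x != s -> has_derive_within I w x (dw x) &
    forall x, x \in `[a, b] -> x != s ->
      dw y @[y --> within I (nbhs x)] --> dw x].
Proof.
move=> cq; have [u mu_u [[B uB] fixu]] := picard_fixpoint.
have cu : {within I, continuous u}.
  apply: subspace_eq_continuous (picard_continuous mu_u uB) => x.
  by rewrite inE; exact: fixu.
have cu' x : x \in `[a, b] -> u y @[y --> within I (nbhs x)] --> u x.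
  by move/within_continuousP : cu; exact.
have cw := weighted_slope_continuous mu_u uB.
have cw' x : x \in `[a, b] ->
    weighted_slope u y @[y --> within I (nbhs x)] --> weighted_slope u x.
  by move/within_continuousP : cw; exact.
have cp' x : x \in `[a, b] -> p y @[y --> within I (nbhs x)] --> p x.
  by move/within_continuousP : weight_continuous; exact.
exists u, (weighted_slope u),
  (fun x => p x * q x * u x / p x - weighted_slope u x * dp x / p x); split=> //.
- split.
  + move=> x xI; apply: (eq_has_derive_within fixu xI).
    exact: has_derive_within_picard mu_u uB _ xI.
  + by rewrite -fixu// picard_at.
  + exact: weighted_slope_at.
  + by move=> x xI; exact: mul_weighted_slope.
- move=> x xI xs.
  have eqpw y : I y -> p s * c +
      oriented_integral a (fun t => p t * q t * u t) s y =
      (p \* weighted_slope u) y.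
    by move=> yI; rewrite /= mul_weighted_slope.
  apply: (eq_has_derive_within eqpw xI); rewrite -[p x * q x * u x]add0r.
  apply: has_derive_withinD; first exact: has_derive_within_cst.
  apply: has_derive_within_oriented_integral => //.
    exact: integrable_coef mu_u uB.
  by apply: cvgM; [apply: cvgM; [exact: cp'|exact: cq]|exact: cu'].
- move=> x xI xs; apply: (has_derive_within_weighted_slope mu_u uB) => //.
    exact: cq.
  exact: cu'.
- move=> x xI xs; have px0 : p x != 0 by rewrite gt_eqF// p_gt0.
  apply: cvgB; (apply: cvgM; last by apply: cvgV => //; exact: cp').
    by apply: cvgM; [apply: cvgM; [exact: cp'|exact: cq]|exact: cu'].
  by apply: cvgM; [exact: cw'|exact: dp_continuous].
Qed.

End existence.

End weighted_problem.

(** * The weight [r^m], and translation between [is_solution] and the weighted problem *)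

Section radial_weight.
Context {R : realType}.
Variables s0 delta m : R.
Hypotheses (s0_ge0 : 0 <= s0) (delta_gt0 : 0 < delta) (m_ge0 : 0 <= m).
Hypothesis reg : 0 < s0 -> delta < s0.
Local Notation lo := (Num.max 0 (s0 - delta)).
Local Notation hi := (s0 + delta).
Local Notation I := (interval_of s0 delta).
Local Notation J := (punctured_interval_of s0 delta).
Local Notation mu := (@lebesgue_measure R).

Lemma radial_lt : lo < hi.
Proof. by rewrite gt_max ltr_wpDl//= ltrBlDr -addrA ltrDl addr_gt0. Qed.

Lemma radial_center : s0 \in `[lo, hi].
Proof. by rewrite in_itv/= ge_max s0_ge0/= lerBlDr lerDl ltW. Qed.

Lemma radial_ge0 x : x \in `[lo, hi] -> 0 <= x.
Proof. by rewrite in_itv/= ge_max => /andP[/andP[]]. Qed.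

Lemma radial_gt0 x : x \in `[lo, hi] -> x != s0 -> 0 < x.
Proof.
move=> xI xs0; have := radial_ge0 xI; rewrite le_eqVlt => /predU1P[x0|//].
have [s00|s00] := eqVneq s0 0; first by move: xs0; rewrite s00 x0 eqxx.
have : 0 < s0 by rewrite lt_neqAle eq_sym s00.
move=> /reg; rewrite -subr_gt0 => /lt_le_trans; apply.
by move: xI; rewrite in_itv/= ge_max => /andP[/andP[]].
Qed.

Lemma punctured_mem x : J x <-> x \in `[lo, hi] /\ x != s0.
Proof. by split=> [[xI /eqP]|[xI /eqP]]. Qed.

Lemma powR_weight_gt0 x : x \in `[lo, hi] -> x != s0 -> 0 < x `^ m.
Proof. by move=> xI xs0; apply: powR_gt0; exact: radial_gt0. Qed.

Lemma powR_weight_derive x : x \in `[lo, hi] -> x != s0 ->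
  has_derive_within I (@powR R ^~ m) x (m * x `^ (m - 1)).
Proof.
move=> xI xs0; apply: is_derive_has_derive_within.
by apply: is_derive1_powR; exact: radial_gt0.
Qed.

Lemma powR_weight_derive_continuous x : x \in `[lo, hi] -> x != s0 ->
  m * y `^ (m - 1) @[y --> within I (nbhs x)] --> m * x `^ (m - 1).
Proof.
move=> xI xs0; apply: cvgM; first exact: cvg_cst.
apply: has_derive_within_continuous; apply: is_derive_has_derive_within.
by apply: is_derive1_powR; exact: radial_gt0.
Qed.

Lemma powR_weight_continuous_at :
  y `^ m @[y --> within I (nbhs s0)] --> s0 `^ m.
Proof.
have [s00|s00] := eqVneq s0 0; last first.
  apply: has_derive_within_continuous; apply: is_derive_has_derive_within.
  by apply: is_derive1_powR; rewrite lt_neqAle eq_sym s00.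
(* At the origin [0^0 = 1], so [m = 0] gives the constant weight 1; only [m > 0] makes the weight
   vanish there. *)
have [m0|m0] := eqVneq m 0.
  rewrite m0 powRr0; under eq_fun do rewrite powRr0.
  exact: cvg_cst.
have m_gt0 : 0 < m by rewrite lt_neqAle eq_sym m0.
have -> : s0 `^ m = 0 by rewrite s00 powR0.
apply/cvgrPdist_le => e e0.
have /cvgrPdist_le/(_ _ e0) := powR_cvg0 m_gt0.
rewrite near_withinE => /nbhs_ballP[d d0 dP].
apply/near_withinP; exists d => // y yI yd.
have := radial_ge0 yI; rewrite le_eqVlt => /predU1P[<-|y0].
  by rewrite powR0// subrr normr0 ltW.
by apply: dP => //; rewrite /ball/= distrC -s00.
Qed.

(** For [s0 = 0] the distance to [s0] is the variable itself, and monotonicity gives [K = 1]. For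
    [s0 > 0] the segment stays away from the origin, and [K] is the ratio of the extreme values of
    the weight. Either way [K] depends only on [m], [s0] and [delta]. *)
Lemma powR_weight_le : exists2 K, 1 <= K & forall x t,
  x \in `[lo, hi] -> t \in `[lo, hi] -> `|t - s0| <= `|x - s0| ->
  t `^ m <= K * x `^ m.
Proof.
have [s00|s00] := eqVneq s0 0.
  exists 1 => // x t xI tI; have x0 := radial_ge0 xI; have t0 := radial_ge0 tI.
  rewrite mul1r s00 !subr0 !ger0_norm// => tx.
  by apply: ge0_ler_powR; rewrite // nnegrE.
have sd : 0 < s0 - delta by rewrite subr_gt0 reg// lt_neqAle eq_sym s00.
have hi0 : 0 <= hi by rewrite addr_ge0// ltW.
have pos := powR_gt0 m sd.
have mono x y : 0 <= x -> x <= y -> x `^ m <= y `^ m.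
  move=> x0 xy; apply: ge0_ler_powR; rewrite // nnegrE//; exact: le_trans xy.
exists (hi `^ m / (s0 - delta) `^ m).
  rewrite ler_pdivlMr// mul1r mono//; first exact: ltW.
  by rewrite lerBlDr -addrA lerDl addr_ge0// ltW.
move=> x t xI tI _.
rewrite mulrAC ler_pdivlMr//; apply: ler_pM; rewrite ?powR_ge0//.
  by apply: mono; [exact: radial_ge0|move: tI; rewrite in_itv/= => /andP[]].
apply: mono; first exact: ltW.
by move: xI; rewrite in_itv/= ge_max => /andP[/andP[]].
Qed.

Lemma has_derive_within_interval f x l : x \in `[lo, hi] ->
  has_derive_within I f x l <-> derivable_within I f x /\ derive_within I f x = l.
Proof.
by move=> xI; apply: has_derive_withinP; exact: within_dnbhs_proper radial_lt xI.
Qed.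

Lemma has_derive_within_punctured f x l : x \in `[lo, hi] -> x != s0 ->
  has_derive_within I f x l <-> derivable_within J f x /\ derive_within J f x = l.
Proof.
move=> xI xs0; rewrite -(has_derive_withinD1 I f l xs0).
apply: has_derive_withinP; rewrite within_dnbhsD1//.
exact: within_dnbhs_proper radial_lt xI.
Qed.

Lemma derive_within_punctured f x : x != s0 ->
  derive_within J f x = derive_within I f x.
Proof. by move=> xs0; rewrite /derive_within within_dnbhsD1. Qed.

Lemma admissible_continuous q : admissible_coef s0 delta q ->
  forall x, x \in `[lo, hi] -> x != s0 ->
    q y @[y --> within I (nbhs x)] --> q x.
Proof.
move=> [_ /within_continuousP cq] x xI xs0.
by rewrite -(within_nbhsD1 I xs0); apply: cq; apply/punctured_mem.
Qed.

Local Notation weighted_solution := (weighted_solution lo hi s0 (@powR R ^~ m)).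

Lemma is_solution_weighted b c q u : admissible_coef s0 delta q ->
  is_solution s0 delta m b c q u ->
  weighted_solution q b c u (derive_within I u).
Proof.
move=> aq [[du cu'] [_ [ddu _]] eqn us u's].
have uw x : x \in `[lo, hi] -> has_derive_within I u x (derive_within I u x).
  by move=> xI; apply/has_derive_within_interval => //; split=> //; exact: du.
apply: (weighted_solution_of_derive radial_lt radial_center powR_weight_derive
  powR_weight_continuous_at aq.1 (admissible_continuous aq) uw cu' us u's).
move=> x xI xs0; have xJ : J x by exact/punctured_mem.
rewrite -(eqn x xJ); apply/(has_derive_within_punctured _ _ xI xs0).
(* The equation only fixes a value of [derive_within]; that [r^m u'] is differentiable comes from
   the C^2 regularity and the product rule. *)
have dw : has_derive_within J (derive_within J u) x (derive_within J (derive_within J u) x).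
  exact: ddu.
have dp : has_derive_within J (@powR R ^~ m) x (m * x `^ (m - 1)).
  by apply/has_derive_withinD1 => //; exact: powR_weight_derive.
have dpw := has_derive_withinM dp dw.
have eqJ y : J y -> (@powR R ^~ m \* derive_within J u) y =
    (@powR R ^~ m \* derive_within I u) y.
  by move=> /punctured_mem[_ ys0]; rewrite /= derive_within_punctured.
have dpw' := eq_has_derive_within eqJ xJ dpw.
move/(has_derive_withinD1 _ _ _ xs0) : dpw' => /(has_derive_within_punctured _ _ xI xs0)[h1 h2].
move/(has_derive_withinD1 _ _ _ xs0) : dpw => /(has_derive_within_punctured _ _ xI xs0)[h3 h4].
by split=> //; rewrite h2 -h4.
Qed.

Lemma weighted_is_solution b c q u w dw : weighted_solution q b c u w ->
  {within I, continuous w} ->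
  (forall x, x \in `[lo, hi] -> x != s0 ->
    has_derive_within I (@powR R ^~ m \* w) x (x `^ m * q x * u x)) ->
  (forall x, x \in `[lo, hi] -> x != s0 -> has_derive_within I w x (dw x)) ->
  (forall x, x \in `[lo, hi] -> x != s0 ->
    dw y @[y --> within I (nbhs x)] --> dw x) ->
  is_solution s0 delta m b c q u.
Proof.
move=> [uw us ws _] cw pw ww cdw.
have derI x : x \in `[lo, hi] -> derive_within I u x = w x.
  by move=> xI; have [_] := (has_derive_within_interval _ _ xI).1 (uw _ xI).
have derJ x : x \in `[lo, hi] -> x != s0 -> derive_within J u x = w x.
  by move=> xI xs0; rewrite derive_within_punctured// derI.
have eqJ x : J x -> w x = derive_within J u x.
  by move=> /punctured_mem[xI xs0]; rewrite derJ.
have wwJ x : x \in `[lo, hi] -> x != s0 ->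
    has_derive_within I (derive_within J u) x (dw x).
  move=> xI xs0; apply/(has_derive_withinD1 _ _ _ xs0).
  apply: (eq_has_derive_within eqJ); first exact/punctured_mem.
  by apply/(has_derive_withinD1 _ _ _ xs0); exact: ww.
split => //.
- split; first by move=> x xI; have [] := (has_derive_within_interval _ _ xI).1 (uw _ xI).
  by apply: subspace_eq_continuous cw => x /set_mem xI; exact/esym/derI.
- split; split.
  + move=> x /punctured_mem[xI xs0].
    by have [] := (has_derive_within_punctured _ _ xI xs0).1 (uw _ xI).
  + have cwJ : {within J, continuous w}.
      by apply: continuous_subspaceW cw => x [].
    by apply: subspace_eq_continuous cwJ => x /set_mem; exact: eqJ.
  + move=> x /punctured_mem[xI xs0].
    by have [] := (has_derive_within_punctured _ _ xI xs0).1 (wwJ _ xI xs0).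
  + have cdwJ : {within J, continuous dw}.
      apply/within_continuousP => x /punctured_mem[xI xs0].
      by rewrite within_nbhsD1//; exact: cdw.
    apply: subspace_eq_continuous cdwJ => x /set_mem/punctured_mem[xI xs0]; apply/esym.
    by have [_] := (has_derive_within_punctured _ _ xI xs0).1 (wwJ _ xI xs0).
- move=> x xJ; have [xI xs0] := (punctured_mem _).1 xJ.
  suff : has_derive_within I (fun t => t `^ m * derive_within J u t) x
      (x `^ m * q x * u x).
    by move=> /(has_derive_within_punctured _ _ xI xs0)[].
  apply/(has_derive_withinD1 _ _ _ xs0).
  have eqpw y : J y -> (@powR R ^~ m \* w) y = y `^ m * derive_within J u y.
    by move=> /eqJ <-.
  apply: (eq_has_derive_within eqpw xJ).
  by apply/(has_derive_withinD1 _ _ _ xs0); exact: pw.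
- by rewrite derI//; exact: radial_center.
Qed.

Lemma L1normE (f : R -> R) : mu.-integrable I (EFin \o f) ->
  L1norm I f = (\int[mu]_(t in I) `|f t|)%:E.
Proof.
move=> intf; rewrite /Rintegral fineK//.
by apply: integrable_fin_num; [exact: measurable_itv|exact: integrable_norm intf].
Qed.

Lemma le_C1norm f df M1 M2 :
  (forall x, x \in `[lo, hi] -> has_derive_within I f x (df x)) ->
  (forall x, x \in `[lo, hi] -> `|f x| <= M1) ->
  (forall x, x \in `[lo, hi] -> `|df x| <= M2) ->
  (C1norm I f <= (M1 + M2)%:E)%E.
Proof.
move=> fdf fM dfM; rewrite /C1norm EFinD; apply: leeD; apply: ge_ereal_sup.
  by move=> _ [x xI <-]; rewrite lee_fin fM.
move=> _ [x xI <-]; rewrite lee_fin.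
by have [_ ->] := (has_derive_within_interval _ _ xI).1 (fdf _ xI); exact: dfM.
Qed.

End radial_weight.

Unset Implicit Arguments.

Theorem proposition2p1 (R : realType) (s0 delta m b c : R)
    (hs0 : 0 <= s0) (hdelta : 0 < delta) (hm : 0 <= m)
    (hsing : s0 = 0 -> 0 < m -> 0 < b /\ c = 0)
    (hreg : 0 < s0 -> delta < s0) :
  (forall a : R -> R, admissible_coef s0 delta a ->
     exists u : R -> R, is_solution s0 delta m b c a u /\
       forall v : R -> R, is_solution s0 delta m b c a v ->
         forall r : R, interval_of s0 delta r -> v r = u r) /\
  (forall A : R, exists eps C : R, 0 < eps /\ 0 < C /\
     forall a abar u ubar : R -> R,
       admissible_coef s0 delta a -> admissible_coef s0 delta abar ->
       L1norm (interval_of s0 delta) a = A%:E ->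
       is_solution s0 delta m b c a u ->
       is_solution s0 delta m b c abar ubar ->
       (L1norm (interval_of s0 delta) (abar \- a)%R < eps%:E)%E ->
       (C1norm (interval_of s0 delta) (ubar \- u)%R <=
          C%:E * L1norm (interval_of s0 delta) (abar \- a)%R)%E).
Proof.
have ab := radial_lt hs0 hdelta; have sI := radial_center hs0 hdelta.
have p_gt0 := powR_weight_gt0 m hs0 hreg.
have ps_ge0 : 0 <= s0 `^ m by exact: powR_ge0.
have p_derive := powR_weight_derive (m := m) hs0 hreg.
have dp_continuous := powR_weight_derive_continuous (m := m) hs0 hreg.
have p_continuous_at := powR_weight_continuous_at delta hs0 hm.
have [K K_ge1 p_le] := powR_weight_le hs0 hdelta hm hreg.
have K_ge0 : 0 <= K by exact: le_trans K_ge1.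
(* The weight vanishes at [s0] only when [s0 = 0] and [m > 0], the case in which [c = 0] is
   assumed. *)
have pc : 0 < s0 `^ m \/ c = 0.
  have [s00|s00] := eqVneq s0 0; last first.
    by left; apply: powR_gt0; rewrite lt_neqAle eq_sym s00.
  have [m0|m0] := eqVneq m 0; first by left; rewrite m0 powRr0.
  by right; have [] := hsing s00; rewrite // lt_neqAle eq_sym m0.
have stable := weighted_solution_stable ab sI p_gt0 ps_ge0 p_derive
  p_continuous_at K_ge1 p_le.
have weighted q u := @is_solution_weighted R s0 delta m hs0 hdelta hm hreg b c q u.
split=> [a aa|A].
  have [u [w [dw [sol cw pw ww cdw]]]] := weighted_solution_exists ab sI p_gt0
    ps_ge0 p_derive dp_continuous p_continuous_at K_ge1 p_le b aa.1 pc
    (admissible_continuous aa).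
  have solu : is_solution s0 delta m b c a u .
    exact: (weighted_is_solution hs0 hdelta sol cw pw ww cdw).
  exists u; split=> // v /(weighted _ _ aa) solv r rI.
  have solu' := weighted _ _ aa solu.
  have [B _ uB] := within_continuous_bounded ab (weighted_solution_continuous solu').
  (* Uniqueness is stability with equal coefficients: the integral of their difference vanishes, and
     with it the bound. *)
  have [+ _] := stable _ _ _ _ _ _ _ _ _ _ r aa.1 aa.1 solu' solv uB (lexx _) rI.
  under eq_Rintegral do rewrite /= subrr normr0.
  rewrite Rintegral_cst// mul0r !mulr0 mul0r normr_le0 subr_eq0 => /eqP.
  exact.
pose len := s0 + delta - Num.max 0 (s0 - delta).
(* [B] bounds [|u|] on the whole interval, and [E] is the stability bound divided by the norm of
   [abar - a]. Both are fixed before the coefficients, while [A] is still an arbitrary real, hence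
   the absolute values. *)
have [B BE] : {B | B = 2 * (`|b| + K * `|c|) * expR ((2 * (K * `|A|) + 1) * len)}.
  by eexists.
have [E EE] : {E | E = 2 * (K * B) * expR ((2 * (K * (`|A| + 1)) + 1) * len)}.
  by eexists.
have B0 : 0 <= B by rewrite BE mulr_ge0 ?expR_ge0// mulr_ge0// addr_ge0// mulr_ge0.
have E0 : 0 <= E by rewrite EE mulr_ge0 ?expR_ge0// mulr_ge0// mulr_ge0.
have A1 : 0 <= `|A| + 1 by rewrite addr_ge0.
have C0 : 0 <= E + (K * B + K * (`|A| + 1) * E) by rewrite !addr_ge0// ?mulr_ge0//; rewrite mulr_ge0.
(* Smallness serves to keep the norm of [abar] below [|A| + 1], so the threshold 1 works. In the
   constant, [E] accounts for the functions, the bracket for their derivatives, and the final 1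
   makes it positive. *)
exists 1, (E + (K * B + K * (`|A| + 1) * E) + 1); split=> //; split.
  by rewrite ltr_wpDl.
move=> a abar u ubar aa aabar + /(weighted _ _ aa) solu /(weighted _ _ aabar) solubar.
have intd : lebesgue_measure.-integrable (interval_of s0 delta) (EFin \o (abar \- a)).
  have -> : EFin \o (abar \- a) = ((EFin \o abar) \- (EFin \o a))%E by exact/funext.
  by apply: integrableB; [exact: measurable_itv|exact: aabar.1|exact: aa.1].
rewrite (L1normE aa.1) (L1normE intd) => -[aA]; rewrite lte_fin.
set D := Rintegral _ _ _ => D1.
have A0 : 0 <= A by rewrite -aA; exact: Rintegral_ge0.
have D0 : 0 <= D by exact: Rintegral_ge0.
have abarA : \int[lebesgue_measure]_(t in interval_of s0 delta) `|abar t| <= `|A| + 1.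
  apply: le_trans (le_Rintegral_norm_sub _ aa.1 aabar.1) _; first exact: measurable_itv.
  by rewrite aA ger0_norm// lerD2l ltW.
have uB x : x \in `[Num.max 0 (s0 - delta), s0 + delta] -> `|u x| <= B.
  move=> xI.
  have := weighted_solution_bound ab sI p_gt0 ps_ge0 p_derive p_continuous_at K_ge1
    p_le aa.1 solu xI.
  rewrite aA => /le_trans; apply; rewrite BE (ger0_norm A0).
  apply: ler_wpM2l; first by rewrite mulr_ge0// addr_ge0// mulr_ge0.
  rewrite ler_expR; apply: ler_wpM2l; first by rewrite addr_ge0// mulr_ge0// mulr_ge0.
  exact: itv_dist_le.
have dE x : x \in `[Num.max 0 (s0 - delta), s0 + delta] ->
    `|ubar x - u x| <= E * D /\
    `|derive_within (interval_of s0 delta) ubar x -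
      derive_within (interval_of s0 delta) u x| <=
    (K * B + K * (`|A| + 1) * E) * D.
  move=> xI.
  have := stable _ _ _ _ _ _ _ _ _ _ x aa.1 aabar.1 solu solubar uB abarA xI.
  rewrite /= -/D -/len.
  have -> : 2 * (K * B * D) * expR ((2 * (K * (`|A| + 1)) + 1) * len) = E * D.
    by rewrite EE; ring.
  by rewrite mulrA -mulrDl.
have [uw _ _ _] := solu; have [ubarw _ _ _] := solubar.
apply: le_trans (le_C1norm hs0 hdelta _ (fun x xI => (dE x xI).1)
  (fun x xI => (dE x xI).2)) _.
  by move=> x xI; apply: has_derive_withinB; [exact: ubarw|exact: uw].
by rewrite -EFinM lee_fin -mulrDl ler_wpM2r// lerDl.
Qed.
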